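(* Consider the compressible Navier--Stokes equations in arbitrary Lagrangian--Eulerian (ALE) form on the reference unit cube $\hat\Omega=[0,1]^3$, with grid velocity $\boldsymbol{\mathcal{V}}=(\mathcal{V}_1,\mathcal{V}_2,\mathcal{V}_3)$ and fluid velocity $\boldsymbol{\mathcal{U}}=(\mathcal{U}_1,\mathcal{U}_2,\mathcal{U}_3)$, and the entropy balance in which only the wall face $\{\xi_1=0\}$ is retained (the contributions of the remaining faces being assumed entropy conservative): $$\frac{\mathrm{d}}{\mathrm{d}\tau}\int_{\hat\Omega}\mathcal{J}\mathcal{S}\,\mathrm{d}\xi_1\mathrm{d}\xi_2\mathrm{d}\xi_3=-DT+\int_{\xi_1=0}\sum_{m=1}^{3}\left[\mathcal{J}\frac{\partial\xi_1}{\partial x_m}\left(\mathcal{F}_{x_m}-\mathcal{V}_m\,\mathcal{S}\right)-\boldsymbol{\mathcal{W}}^\top\hat{\mathsf C}_{1m}\frac{\partial\boldsymbol{\mathcal{W}}}{\partial\xi_m}\right]\mathrm{d}\xi_2\,\mathrm{d}\xi_3 .$$ The ALE no-slip boundary conditions $$\mathcal{U}_i=\mathcal{V}_i,\qquad i=1,2,3,$$ on the wall face bound the ALE-inviscid flux contribution $$\int_{\xi_1=0}\sum_{m=1}^{3}\mathcal{J}\frac{\partial \xi_1}{\partial x_m}\left(\mathcal{F}_{x_m}-\mathcal{V}_m\,\mathcal{S}\right)\mathrm{d}\xi_2\,\mathrm{d}\xi_3$$ to the time derivative of the entropy in this balance. The weaker moving no-penetration condition $$\sum_{m=1}^{3}\mathcal{J}\frac{\partial\xi_1}{\partial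 x_m}\left(\mathcal{U}_m-\mathcal{V}_m\right)=0\quad\text{on }\{\xi_1=0\}$$ is sufficient for the inviscid contribution.
   Context: Setting. $\rho>0$ is density, $\boldsymbol{\mathcal{U}}$ velocity, $\mathcal{T}>0$ temperature, $\mathcal{P}=\rho R\mathcal{T}$ pressure ($R$ the gas constant), $c_{\mathcal P}$ the specific heat at constant pressure, $\gamma=c_{\mathcal P}/(c_{\mathcal P}-R)$, $\mathcal{H}=c_{\mathcal{P}}\mathcal{T}+\frac12\boldsymbol{\mathcal{U}}^\top\boldsymbol{\mathcal{U}}$ the specific total enthalpy, $\mathcal{E}=\frac{R}{\gamma-1}\mathcal{T}+\frac12\boldsymbol{\mathcal{U}}^\top\boldsymbol{\mathcal{U}}$ the specific total energy. Conservative variables: $\boldsymbol{\mathcal{Q}}=(\rho,\rho\,\mathcal{U}_1,\rho\,\mathcal{U}_2,\rho\,\mathcal{U}_3,\rho\mathcal{E})^\top$. Inviscid flux: $\boldsymbol{\mathcal{F}}^{(I)}_{x_m}=(\rho\,\mathcal{U}_m,\ \rho\,\mathcal{U}_m\mathcal{U}_1+\delta_{m1}\mathcal{P},\ \rho\,\mathcal{U}_m\mathcal{U}_2+\delta_{m2}\mathcal{P},\ \rho\,\mathcal{U}_m\mathcal{U}_3+\delta_{m3}\mathcal{P},\ \rho\,\mathcal{U}_m\mathcal{H})^\top$. Viscous flux: $\boldsymbol{\mathcal{F}}^{(V)}_{x_m}=(0,\tau_{1m},\tau_{2m},\tau_{3m},\sum_i\tau_{im}\mathcal{U}_i+\kappa\,\partial\mathcal{T}/\partial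 x_m)^\top$ with $\tau_{ij}=\mu(\partial_{x_j}\mathcal{U}_i+\partial_{x_i}\mathcal{U}_j-\frac23\delta_{ij}\sum_n\partial_{x_n}\mathcal{U}_n)$, $\mu=\mu(\mathcal T)$ the dynamic viscosity, $\kappa=\kappa(\mathcal T)$ the thermal conductivity. Mapping. $t=\tau$, $\boldsymbol{x}=\boldsymbol{\chi}(\tau,\boldsymbol{\xi})$ is an invertible mapping from the reference to the physical domain, $\mathcal{J}$ is the determinant of $\partial(t,\boldsymbol{x})/\partial(\tau,\boldsymbol{\xi})$ (equal to $\det(\partial\boldsymbol{x}/\partial\boldsymbol{\xi})$), taken positive, and $\boldsymbol{\mathcal{V}}=\partial\boldsymbol{\chi}/\partial\tau$. The derivatives $\partial\xi_l/\partial x_m$ are those of the inverse mapping. The metric identities $\partial_\tau\mathcal{J}-\sum_{l,m}\partial_{\xi_l}(\mathcal{J}\frac{\partial\xi_l}{\partial x_m}\mathcal{V}_m)=0$ and $\sum_l\partial_{\xi_l}(\mathcal{J}\frac{\partial\xi_l}{\partial x_m})=0$ ($m=1,2,3$) are assumed to hold. ALE form: $\partial_\tau(\mathcal{J}\boldsymbol{\mathcal{Q}})+\sum_{l,m=1}^3\partial_{\xi_l}\big(\mathcal{J}\frac{\partial\xi_l}{\partial x_m}(\boldsymbol{\mathcal{F}}^{(I)}_{x_m}-\mathcal{V}_m\boldsymbol{\mathcal{Q}}-\boldsymbol{\mathcal{F}}^{(V)}_{x_m})\big)=0$. Entropy. Thermodynamic entropy $s=\frac{R}{\gamma-1}\log(\mathcal{T}/\mathcal{T}_\infty)-R\log(\rho/\rho_\infty)$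 with reference constants $\mathcal{T}_\infty,\rho_\infty$. Mathematical entropy $\mathcal{S}=-\rho s$. Entropy variables $\boldsymbol{\mathcal{W}}=(\partial\mathcal{S}/\partial\boldsymbol{\mathcal{Q}})^\top=\big(\frac{\mathcal{H}-\boldsymbol{\mathcal{U}}^\top\boldsymbol{\mathcal{U}}}{\mathcal{T}}-s,\frac{\mathcal{U}_1}{\mathcal{T}},\frac{\mathcal{U}_2}{\mathcal{T}},\frac{\mathcal{U}_3}{\mathcal{T}},-\frac1{\mathcal{T}}\big)^\top$. Entropy flux in direction $x_m$: $\mathcal{F}_{x_m}=\boldsymbol{\mathcal{W}}^\top\boldsymbol{\mathcal{F}}^{(I)}_{x_m}-\rho\,\mathcal{U}_m R=-\rho\,\mathcal{U}_m s$. Viscous terms. $\hat{\mathsf C}_{ln}$ are the mapped viscous coefficient matrices, defined by $\sum_{m}\mathcal{J}\frac{\partial\xi_l}{\partial x_m}\boldsymbol{\mathcal{F}}^{(V)}_{x_m}=\sum_{n}\hat{\mathsf C}_{ln}\frac{\partial\boldsymbol{\mathcal{W}}}{\partial\xi_n}$; the block matrix they form is symmetric positive semi-definite. $DT=\sum_{l,n=1}^3\int_{\hat\Omega}(\partial_{\xi_l}\boldsymbol{\mathcal{W}})^\top\hat{\mathsf C}_{ln}\,\partial_{\xi_n}\boldsymbol{\mathcal{W}}\,\mathrm{d}\hat\Omega\ge0$. The entropy balance is obtained by contracting the ALE system with $\boldsymbol{\mathcal{W}}$ and integrating over $\hat\Omega$; it holds with equality for smooth flows. *)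

(* Defs.v *)
From HB Require Import structures.
From mathcomp Require Import all_boot all_order all_algebra.
From mathcomp Require Import all_classical all_reals all_analysis.

Set Implicit Arguments.
Unset Strict Implicit.
Unset Printing Implicit Defensive.

Import Order.TTheory GRing.Theory Num.Theory.
Import numFieldNormedType.Exports.

Local Open Scope classical_set_scope.
Local Open Scope ring_scope.

Notation dot u v := ((u^T *m v) ord0 ord0).

(* A space-time field is a curried function of the time tau and of the
   reference coordinates xi = (xi_1, xi_2, xi_3), a column vector; the index
   k : 'I_3 stands for the direction of number k + 1.  The directional
   derivatives of the library are total, so a derivative means what it should
   only for fields which are regular in the sense of C_on. *)

Section Calculus.
Context {R : realType}.

Definition dtime {V : normedModType R} (f : R -> 'cV[R]_3 -> V)
    (tau : R) (xi : 'cV[R]_3) : V :=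
  'D_1 (fun t : R => f t xi) tau.

Definition dref {V : normedModType R} (l : 'I_3) (f : R -> 'cV[R]_3 -> V)
    (tau : R) (xi : 'cV[R]_3) : V :=
  'D_(delta_mx l ord0) (f tau) xi.

(* f is k times continuously differentiable on the open set D *)
Fixpoint C_on {V : normedModType R} (k : nat) (D : set (R * 'cV[R]_3))
    (f : R -> 'cV[R]_3 -> V) : Prop :=
  (forall p, D p -> {for p, continuous (fun q => f q.1 q.2)}) /\
  if k is j.+1 then
    [/\ forall tau xi, D (tau, xi) -> derivable (fun t : R => f t xi) tau 1,
        forall l tau xi, D (tau, xi) -> derivable (f tau) xi (delta_mx l ord0),
        C_on j D (dtime f) &
        forall l, C_on j D (dref l f)]
  else True.

Definition gradient (n : nat) (f : 'cV[R]_n.+1 -> R) (q : 'cV[R]_n.+1) :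
    'cV[R]_n.+1 :=
  \col_i 'D_(delta_mx i ord0) f q.

Definition point3 (a b c : R) : 'cV[R]_3 :=
  \col_(i < 3) nth 0 [:: a; b; c] i.

Definition cube : set 'cV[R]_3 :=
  [set xi | forall i, 0 <= xi i ord0 <= 1].

Definition wall : set 'cV[R]_3 :=
  [set xi | cube xi /\ xi ord0 ord0 = 0].

Definition integral_cube (f : 'cV[R]_3 -> R) : R :=
  let mu := @lebesgue_measure R in
  \int[((mu \x mu) \x mu)%E]_(p in (`[0, 1] `*` `[0, 1]) `*` `[0, 1])
    f (point3 p.1.1 p.1.2 p.2).

Definition integral_wall (f : 'cV[R]_3 -> R) : R :=
  let mu := @lebesgue_measure R in
  \int[(mu \x mu)%E]_(p in `[0, 1] `*` `[0, 1]) f (point3 0 p.1 p.2).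

Definition symmetric_psd (n : nat) (M : 'M[R]_n) : Prop :=
  M^T = M /\ forall v : 'cV[R]_n, 0 <= dot v (M *m v).

End Calculus.

Record gas (R : realType) := Gas {
  Rgas : R;
  c_P : R;
  T_inf : R;
  rho_inf : R;
  viscosity : R -> R;
  conductivity : R -> R;
  Rgas_gt0 : 0 < Rgas;
  Rgas_lt_c_P : Rgas < c_P;
  T_inf_gt0 : 0 < T_inf;
  rho_inf_gt0 : 0 < rho_inf;
  viscosity_C1 : forall T, 0 < T ->
    derivable viscosity T 1 /\ {for T, continuous ('D_1 viscosity)};
  conductivity_C1 : forall T, 0 < T ->
    derivable conductivity T 1 /\ {for T, continuous ('D_1 conductivity)}
}.

Section Thermodynamics.
Context {R : realType} (g : gas R).

Definition adiabatic_index : R := c_P g / (c_P g - Rgas g).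

Definition pressure (rho T : R) : R := rho * Rgas g * T.

Definition total_enthalpy (u : 'cV[R]_3) (T : R) : R :=
  c_P g * T + 2^-1 * dot u u.

Definition total_energy (u : 'cV[R]_3) (T : R) : R :=
  Rgas g / (adiabatic_index - 1) * T + 2^-1 * dot u u.

Definition thermo_entropy (rho T : R) : R :=
  Rgas g / (adiabatic_index - 1) * ln (T / T_inf g)
  - Rgas g * ln (rho / rho_inf g).

Definition math_entropy (rho T : R) : R := - rho * thermo_entropy rho T.

(* the column (a, u_1, u_2, u_3, b) *)
Definition vec5 (a : R) (u : 'cV[R]_3) (b : R) : 'cV[R]_5 :=
  col_mx (a%:M : 'cV_1) (col_mx u (b%:M : 'cV_1)).

Definition conservative (rho : R) (u : 'cV[R]_3) (T : R) : 'cV[R]_5 :=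
  vec5 rho (rho *: u) (rho * total_energy u T).

Definition density_of (Q : 'cV[R]_5) : R := Q ord0 ord0.

Definition velocity_of (Q : 'cV[R]_5) : 'cV[R]_3 :=
  (density_of Q)^-1 *: usubmx (dsubmx (Q : 'cV_(1 + (3 + 1)))).

(* the temperature T solving total_energy u T = Q_5 / rho *)
Definition temperature_of (Q : 'cV[R]_5) : R :=
  (Q ord_max ord0 / density_of Q
   - 2^-1 * dot (velocity_of Q) (velocity_of Q))
  / (Rgas g / (adiabatic_index - 1)).

Definition entropy_of_conservative (Q : 'cV[R]_5) : R :=
  math_entropy (density_of Q) (temperature_of Q).

Definition entropy_variables (Q : 'cV[R]_5) : 'cV[R]_5 :=
  gradient entropy_of_conservative Q.

Definition inviscid_flux (m : 'I_3) (rho : R) (u : 'cV[R]_3) (T : R) :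
    'cV[R]_5 :=
  vec5 (rho * u m ord0)
       (\col_i (rho * u m ord0 * u i ord0 + (m == i)%:R * pressure rho T))
       (rho * u m ord0 * total_enthalpy u T).

Definition entropy_flux (m : 'I_3) (rho : R) (u : 'cV[R]_3) (T : R) : R :=
  dot (entropy_variables (conservative rho u T)) (inviscid_flux m rho u T)
  - rho * u m ord0 * Rgas g.

End Thermodynamics.

(* chi is defined for times in the open set times and for xi in the open
   neighbourhood chart of the reference cube, so that derivatives on the faces
   of the cube are two-sided; chi_inv tau is the inverse of chi tau on the
   image of chart and is arbitrary elsewhere. *)
Record mapping (R : realType) := Mapping {
  times : set R;
  chart : set 'cV[R]_3;
  chi : R -> 'cV[R]_3 -> 'cV[R]_3;
  chi_inv : R -> 'cV[R]_3 -> 'cV[R]_3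
}.

Record flow (R : realType) := Flow {
  density : R -> 'cV[R]_3 -> R;
  velocity : R -> 'cV[R]_3 -> 'cV[R]_3;
  temperature : R -> 'cV[R]_3 -> R
}.

Section ALE.
Context {R : realType} (g : gas R) (M : mapping R).

Definition domain : set (R * 'cV[R]_3) := times M `*` chart M.

Definition spacetime (tau : R) (xi : 'cV[R]_3) : 'cV[R]_4 :=
  col_mx (tau%:M : 'cV_1) (chi M tau xi).

Definition jacobian_matrix (tau : R) (xi : 'cV[R]_3) : 'M[R]_4 :=
  row_mx (dtime spacetime tau xi : 'cV[R]_4)
         (\matrix_(i < 4, l < 3) dref l spacetime tau xi i ord0).

Definition jac (tau : R) (xi : 'cV[R]_3) : R := \det (jacobian_matrix tau xi).

Definition grid_velocity : R -> 'cV[R]_3 -> 'cV[R]_3 := dtime (chi M).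

(* derivative in the direction x_m, at the physical point chi(tau, xi), of the
   field given by f in reference coordinates *)
Definition dphys (m : 'I_3) (f : R -> 'cV[R]_3 -> R)
    (tau : R) (xi : 'cV[R]_3) : R :=
  'D_(delta_mx m ord0) (f tau \o chi_inv M tau) (chi M tau xi).

Definition dxi_dx (l m : 'I_3) : R -> 'cV[R]_3 -> R :=
  dphys m (fun _ xi => xi l ord0).

Record admissible_mapping : Prop := AdmissibleMapping {
  times_open : open (times M);
  chart_open : open (chart M);
  cube_sub_chart : cube `<=` chart M;
  chi_C2 : C_on 2 domain (chi M);
  chiK : forall tau xi, domain (tau, xi) -> chi_inv M tau (chi M tau xi) = xi;
  jac_gt0 : forall tau xi, domain (tau, xi) -> 0 < jac tau xi;
  chi_inv_differentiable : forall tau xi, domain (tau, xi) ->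
    differentiable (chi_inv M tau) (chi M tau xi);
  metric_identity_time : forall tau xi, domain (tau, xi) ->
    dtime jac tau xi
    - \sum_(l < 3) \sum_(m < 3) dref l (fun t x =>
        jac t x * dxi_dx l m t x * grid_velocity t x m ord0) tau xi = 0;
  metric_identity_space : forall m tau xi, domain (tau, xi) ->
    \sum_(l < 3) dref l (fun t x => jac t x * dxi_dx l m t x) tau xi = 0
}.

Record smooth_flow (w : flow R) : Prop := SmoothFlow {
  density_C2 : C_on 2 domain (density w);
  velocity_C2 : C_on 2 domain (velocity w);
  temperature_C2 : C_on 2 domain (temperature w);
  density_gt0 : forall tau xi, domain (tau, xi) -> 0 < density w tau xi;
  temperature_gt0 : forall tau xi, domain (tau, xi) -> 0 < temperature w tau xi
}.

Section Flow.
Variable w : flow R.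

Definition Q_field (tau : R) (xi : 'cV[R]_3) : 'cV[R]_5 :=
  conservative g (density w tau xi) (velocity w tau xi) (temperature w tau xi).

Definition entropy_field (tau : R) (xi : 'cV[R]_3) : R :=
  math_entropy g (density w tau xi) (temperature w tau xi).

Definition W_field (tau : R) (xi : 'cV[R]_3) : 'cV[R]_5 :=
  entropy_variables g (Q_field tau xi).

Definition FI_field (m : 'I_3) (tau : R) (xi : 'cV[R]_3) : 'cV[R]_5 :=
  inviscid_flux g m
    (density w tau xi) (velocity w tau xi) (temperature w tau xi).

Definition entropy_flux_field (m : 'I_3) (tau : R) (xi : 'cV[R]_3) : R :=
  entropy_flux g m
    (density w tau xi) (velocity w tau xi) (temperature w tau xi).

Definition stress (i j : 'I_3) (tau : R) (xi : 'cV[R]_3) : R :=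
  let u k := fun t x => velocity w t x k ord0 in
  viscosity g (temperature w tau xi) *
  (dphys j (u i) tau xi + dphys i (u j) tau xi
   - 2 / 3 * (i == j)%:R * \sum_(n < 3) dphys n (u n) tau xi).

Definition FV_field (m : 'I_3) (tau : R) (xi : 'cV[R]_3) : 'cV[R]_5 :=
  vec5 0 (\col_i stress i m tau xi)
    (\sum_(i < 3) stress i m tau xi * velocity w tau xi i ord0
     + conductivity g (temperature w tau xi) * dphys m (temperature w) tau xi).

Definition ale_navier_stokes : Prop :=
  forall tau xi, times M tau -> cube xi ->
  dtime (fun t x => jac t x *: Q_field t x) tau xi
  + \sum_(l < 3) \sum_(m < 3) dref l (fun t x =>
      (jac t x * dxi_dx l m t x) *:
      (FI_field m t x - grid_velocity t x m ord0 *: Q_field t x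
       - FV_field m t x)) tau xi = 0.

End Flow.

(* The defining identity of the matrices C l n is required at each point for
   every smooth flow taking there the same values as w: the gradient of the
   entropy variables is then arbitrary, so that C l n is determined by the
   state and the metric terms at that point, whereas the identity for the sole
   flow w would not determine it. *)
Definition viscous_coefficients (w : flow R)
    (C : 'I_3 -> 'I_3 -> R -> 'cV[R]_3 -> 'M[R]_5) : Prop :=
  (forall tau xi, times M tau -> cube xi ->
   forall w' : flow R, smooth_flow w' ->
     density w' tau xi = density w tau xi ->
     velocity w' tau xi = velocity w tau xi ->
     temperature w' tau xi = temperature w tau xi ->
   forall l,
     \sum_(m < 3) (jac tau xi * dxi_dx l m tau xi) *: FV_field w' m tau xi
     = \sum_(n < 3) C l n tau xi *m dref n (W_field w') tau xi) /\
  (forall tau xi, times M tau -> cube xi ->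
     symmetric_psd (\mxblock_(l < 3, n < 3) C l n tau xi)).

Section Balance.
Variables (w : flow R) (C : 'I_3 -> 'I_3 -> R -> 'cV[R]_3 -> 'M[R]_5).

Definition total_entropy (tau : R) : R :=
  integral_cube (fun xi => jac tau xi * entropy_field w tau xi).

Definition DT (tau : R) : R :=
  \sum_(l < 3) \sum_(n < 3) integral_cube (fun xi =>
    dot (dref l (W_field w) tau xi)
        (C l n tau xi *m dref n (W_field w) tau xi)).

Definition entropy_balance (tau : R) : Prop :=
  is_derive tau 1 total_entropy
    (- DT tau + integral_wall (fun xi => \sum_(m < 3)
       (jac tau xi * dxi_dx ord0 m tau xi
          * (entropy_flux_field w m tau xi
             - grid_velocity tau xi m ord0 * entropy_field w tau xi)
        - dot (W_field w tau xi)
              (C ord0 m tau xi *m dref m (W_field w) tau xi)))).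

Definition inviscid_wall_contribution (tau : R) : R :=
  integral_wall (fun xi => \sum_(m < 3) jac tau xi * dxi_dx ord0 m tau xi
    * (entropy_flux_field w m tau xi
       - grid_velocity tau xi m ord0 * entropy_field w tau xi)).

Definition viscous_wall_contribution (tau : R) : R :=
  integral_wall (fun xi => \sum_(m < 3)
    - dot (W_field w tau xi) (C ord0 m tau xi *m dref m (W_field w) tau xi)).

Definition no_slip (tau : R) : Prop :=
  forall xi, wall xi -> forall i,
    velocity w tau xi i ord0 = grid_velocity tau xi i ord0.

Definition no_penetration (tau : R) : Prop :=
  forall xi, wall xi ->
    \sum_(m < 3) jac tau xi * dxi_dx ord0 m tau xi
      * (velocity w tau xi m ord0 - grid_velocity tau xi m ord0) = 0.

(* Since the inviscid contribution has no sign a priori and is not controlled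
   by DT, bounding it means that it vanishes, so that it drops out of the
   entropy balance. *)
Definition inviscid_contribution_bounded (tau : R) : Prop :=
  inviscid_wall_contribution tau = 0 /\
  is_derive tau 1 total_entropy (- DT tau + viscous_wall_contribution tau).

End Balance.
End ALE.

(* Main.v *)
(** Contracting the inviscid flux with the gradient of the mathematical entropy
    gives [F_m = - rho U_m s], so that [F_m - V_m S = S (U_m - V_m)].  At each
    point of the wall the inviscid integrand is therefore [S] times the
    no-penetration expression, and it drops out of the boundary integral of the
    balance. *)

Require Import Defs.
From mathcomp Require Import all_boot all_order all_algebra.
From mathcomp Require Import all_classical all_reals all_analysis.
From mathcomp Require Import ring lra.

Set Implicit Arguments.
Unset Strict Implicit.
Unset Printing Implicit Defensive.

Import Order.TTheory GRing.Theory Num.Theory.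
Import numFieldNormedType.Exports.

Local Open Scope classical_set_scope.
Local Open Scope ring_scope.

(** * Derivatives along lines, and coordinates of five-component columns *)

(** The two difference quotients coincide. This brings the gradient in ['cV_5] down to the calculus
    of functions of one real variable. *)
Lemma derive_line (R : realType) (V W : normedModType R) (f : V -> W)
    (a v : V) :
  'D_v f a = 'D_1 (fun h : R => f (h *: v + a)) 0.
Proof.
rewrite /derive; set F := (X in lim (X @ _)); set G := (X in _ = lim (X @ _)).
suff -> : F = G by [].
by apply/funext => h; rewrite /F /G /= scale0r add0r addr0 [h *: 1]mulr1.
Qed.

Lemma dotE (R : realType) n (u v : 'cV[R]_n) :
  dot u v = \sum_i u i ord0 * v i ord0.
Proof. by rewrite mxE; apply: eq_bigr => i _; rewrite mxE. Qed.

(** Position of a momentum component, following the nesting 1 + (3 + 1) of [vec5]. *)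
Definition mid (i : 'I_3) : 'I_5 := rshift 1 (lshift 1 i).

Lemma ord_max_rshift : (ord_max : 'I_5) = rshift 1 (rshift 3 ord0).
Proof. exact: val_inj. Qed.

Lemma sum5E (R : realType) (F : 'I_5 -> R) :
  \sum_i F i = F ord0 + (\sum_i F (mid i) + F ord_max).
Proof.
rewrite (@big_split_ord _ _ _ 1 4) big_ord1 /=; congr (F _ + _).
  exact: val_inj.
rewrite (@big_split_ord _ _ _ 3 1) big_ord1 /=; congr (_ + F _).
exact: val_inj.
Qed.

Section Vec5.
Context {R : realType} (a b : R) (u : 'cV[R]_3).

Lemma vec5_first : vec5 a u b ord0 ord0 = a.
Proof.
rewrite /vec5 (_ : ord0 = lshift (3 + 1) (ord0 : 'I_1)); last exact: val_inj.
by apply: etrans (col_mxEu _ _ _ _) _; rewrite mxE eqxx mulr1n.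
Qed.

Lemma vec5_mid i : vec5 a u b (mid i) ord0 = u i ord0.
Proof. exact: etrans (col_mxEd _ _ _ _) (col_mxEu _ _ _ _). Qed.

Lemma vec5_last : vec5 a u b ord_max ord0 = b.
Proof.
rewrite ord_max_rshift.
apply: etrans (col_mxEd _ _ _ _) (etrans (col_mxEd _ _ _ _) _).
by rewrite mxE eqxx mulr1n.
Qed.

End Vec5.

Lemma velocity_ofE (R : realType) (Q : 'cV[R]_5) i :
  velocity_of Q i ord0 = Q (mid i) ord0 / Q ord0 ord0.
Proof. by rewrite mxE [X in _ * X]mxE mxE mulrC. Qed.

(** Velocity and specific energy are quotients of components of [Q], each affine along a line. In
    this form of the quotient rule the value [p / q] stays visible. *)
Lemma is_derive_line_quotient (R : realType) (p dp q dq : R) : q != 0 ->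
  is_derive (0 : R) 1 (fun h => (h * dp + p) / (h * dq + q))
    ((dp - p / q * dq) / q).
Proof.
move=> q0.
have lin (a b : R) : is_derive (0 : R) 1 (fun h => h * a + b) a.
  have D := is_deriveD (is_deriveM (is_derive_id (0 : R) 1)
    (is_derive_cst a (0 : R) 1)) (is_derive_cst b (0 : R) 1).
  refine (is_derive_eq D _).
  by rewrite scaler0 add0r addr0 [_ *: _]mulr1.
have q0' : 0 * dq + q != 0 by rewrite mul0r add0r.
have D := is_deriveM (lin dp p)
  (is_deriveV (f := fun h => h * dq + q) q0' (lin dq q)).
refine (is_derive_eq D _).
rewrite /= !mul0r !add0r /GRing.scale /=; field; exact: q0.
Qed.

(** * Entropy variables and entropy flux in closed form *)

Section EntropyVariables.
Context {R : realType} (g : gas R).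

(** Mayer's relation: this coefficient is the specific heat at constant volume, written c_v
    below. *)
Lemma heat_capacityE : Rgas g / (adiabatic_index g - 1) = c_P g - Rgas g.
Proof.
have h := Rgas_gt0 g; have h' := Rgas_lt_c_P g.
rewrite /adiabatic_index; field; apply/andP; split; last by lra.
by rewrite subr_eq0; apply/eqP; lra.
Qed.

Lemma temperature_ofE (Q : 'cV[R]_5) :
  temperature_of g Q =
  (Q ord_max ord0 / Q ord0 ord0
   - 2^-1 * \sum_i (Q (mid i) ord0 / Q ord0 ord0) ^+ 2) / (c_P g - Rgas g).
Proof.
rewrite /temperature_of heat_capacityE dotE /density_of.
congr ((_ - _ * _) / _).
by apply: eq_bigr => i _; rewrite !velocity_ofE expr2.
Qed.

(** This is dT = (dE - U . dU) / c_v, with dE and dU given by the quotient rule. *)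
Lemma is_derive_temperature (Q v : 'cV[R]_5) : Q ord0 ord0 != 0 ->
  is_derive (0 : R) 1 (fun h => temperature_of g (h *: v + Q))
    (((v ord_max ord0 - Q ord_max ord0 / Q ord0 ord0 * v ord0 ord0)
       / Q ord0 ord0
      - \sum_i velocity_of Q i ord0
          * ((v (mid i) ord0 - velocity_of Q i ord0 * v ord0 ord0)
             / Q ord0 ord0))
     / (c_P g - Rgas g)).
Proof.
move=> r0.
have Dj j := is_derive_line_quotient (Q j ord0) (v j ord0) (v ord0 ord0) r0.
have D := is_deriveM (is_deriveB (Dj ord_max)
  (is_deriveM (is_derive_cst (2^-1 : R) (0 : R) 1)
     (is_derive_sum (fun i : 'I_3 => is_deriveX 2 (Dj (mid i))))))
  (is_derive_cst (c_P g - Rgas g)^-1 (0 : R) 1).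
set F := (F in is_derive _ _ F _) in D.
have -> : (fun h : R => temperature_of g (h *: v + Q)) = F.
  apply/funext => h; rewrite temperature_ofE !mxE /F [in RHS]/GRing.mul /=.
  congr ((_ - _ * _) * _); rewrite fct_sumE.
  by apply: eq_bigr => i _; rewrite !mxE.
refine (is_derive_eq D _).
rewrite !scaler0 add0r addr0 [_ *: _]mulrC; congr ((_ - _) / _).
rewrite [_ *: _]mulr_sumr; apply: eq_bigr => i _.
rewrite velocity_ofE !mul0r !add0r expr1 /GRing.scale /=.
(* The 2 from differentiating the squares cancels the 1/2 of the kinetic energy. *)
by rewrite !mulrA mulVf ?pnatr_eq0 // mul1r.
Qed.

(** Product rule dS = - s d(rho) - rho ds, with ds = c_v dT / T - R d(rho) / rho; the reference
    constants disappear from the logarithmic derivatives. *)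
Lemma is_derive_math_entropy (r T : R -> R) (x dr dT : R) :
  is_derive x 1 r dr -> is_derive x 1 T dT -> 0 < r x -> 0 < T x ->
  is_derive x 1 (fun h => math_entropy g (r h) (T h))
    (- dr * thermo_entropy g (r x) (T x)
     - r x * ((c_P g - Rgas g) * (dT / T x) - Rgas g * (dr / r x))).
Proof.
move=> Dr DT r0 T0.
have Dln (f : R -> R) df c : is_derive x 1 f df -> 0 < f x -> 0 < c ->
    is_derive x 1 (fun h => ln (f h / c)) (df / f x).
  move=> Df f0 c0.
  have Dfc := is_deriveM Df (is_derive_cst c^-1 x 1).
  have D := is_derive1_comp (g := f * cst c^-1)
    (is_derive1_ln (divr_gt0 f0 c0)) Dfc.
  refine (is_derive_eq D _).
  rewrite scaler0 add0r [_ *: _]mulrC /=; field.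
  by rewrite !gt_eqF.
have D := is_deriveM (is_deriveN Dr) (is_deriveB
  (is_deriveM (is_derive_cst (Rgas g / (adiabatic_index g - 1)) x 1)
    (Dln _ _ _ DT T0 (T_inf_gt0 g)))
  (is_deriveM (is_derive_cst (Rgas g) x 1) (Dln _ _ _ Dr r0 (rho_inf_gt0 g)))).
refine (is_derive_eq D _).
rewrite !scaler0 !addr0 [_ *: - _]mulrC addrC /thermo_entropy heat_capacityE.
congr (_ + _).
exact: mulNr.
Qed.

Section State.
Variables (rho T : R) (u : 'cV[R]_3).
Hypotheses (rho_gt0 : 0 < rho) (T_gt0 : 0 < T).
Let Q := conservative g rho u T.

Lemma velocity_of_conservative : velocity_of Q = u.
Proof.
apply/colP => i; rewrite velocity_ofE vec5_mid vec5_first mxE.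
by rewrite mulrC mulKf // gt_eqF.
Qed.

Lemma temperature_of_conservative : temperature_of g Q = T.
Proof.
rewrite /temperature_of velocity_of_conservative /density_of vec5_first.
rewrite vec5_last /total_energy heat_capacityE; field.
by rewrite subr_eq0 !gt_eqF ?Rgas_lt_c_P.
Qed.

(** The classical closed form of the entropy variables, to be matched with the gradient that defines
    them. *)
Definition entropy_gradient : 'cV[R]_5 :=
  vec5 ((total_enthalpy g u T - dot u u) / T - thermo_entropy g rho T)
    (T^-1 *: u) (- T^-1).

(** The entropy depends on [Q] only through density and temperature, so the chain rule combines the
    two preceding derivatives; collecting the coefficients of [v] gives the gradient. *)
Lemma is_derive_entropy_of_conservative (v : 'cV[R]_5) :
  is_derive (0 : R) 1 (fun h => entropy_of_conservative g (h *: v + Q))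
    (dot entropy_gradient v).
Proof.
have Q0 : Q ord0 ord0 = rho by rewrite vec5_first.
have Q4 : Q ord_max ord0 = rho * total_energy g u T by rewrite vec5_last.
have Q0_neq0 : Q ord0 ord0 != 0 by rewrite Q0 gt_eqF.
have DT := is_derive_temperature v Q0_neq0.
have Dr : is_derive (0 : R) 1 (fun h => density_of (h *: v + Q)) (v ord0 ord0).
  have D := is_deriveD (is_deriveM (is_derive_id (0 : R) 1)
    (is_derive_cst (v ord0 ord0) (0 : R) 1))
    (is_derive_cst (Q ord0 ord0) (0 : R) 1).
  rewrite (_ : (fun h => _) = id * cst (v ord0 ord0) + cst (Q ord0 ord0)).
    by refine (is_derive_eq D _); rewrite scaler0 add0r addr0 [_ *: _]mulr1.
  by apply/funext => h; rewrite /density_of !mxE.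
have r0 : density_of (0 *: v + Q) = rho by rewrite scale0r add0r.
have T0 : temperature_of g (0 *: v + Q) = T.
  by rewrite scale0r add0r temperature_of_conservative.
have D := is_derive_math_entropy Dr DT.
rewrite r0 T0 in D; refine (is_derive_eq (D rho_gt0 T_gt0) _).
rewrite velocity_of_conservative Q0 Q4.
rewrite dotE sum5E /entropy_gradient vec5_first vec5_last.
(* Both sides are reduced to the scalars [dot u u] and the sum of the u_i v_i, which [field] then
   treats as atoms. *)
have -> : \sum_i u i ord0 * ((v (mid i) ord0 - u i ord0 * v ord0 ord0) / rho)
    = (\sum_i u i ord0 * v (mid i) ord0 - dot u u * v ord0 ord0) / rho.
  rewrite dotE (mulr_suml _ _ _ (v ord0 ord0)) -sumrB mulr_suml.
  by apply: eq_bigr => i _; ring.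
under [X in _ = _ + (X + _)]eq_bigr => i _ do rewrite vec5_mid mxE -mulrA.
rewrite -mulr_sumr.
rewrite /total_energy /total_enthalpy heat_capacityE; field.
by rewrite subr_eq0 !gt_eqF ?Rgas_lt_c_P.
Qed.

Lemma entropy_variables_conservative : entropy_variables g Q = entropy_gradient.
Proof.
apply/colP => j; rewrite mxE derive_line.
rewrite (@derive_val _ _ _ _ _ _ _ (is_derive_entropy_of_conservative _)).
rewrite dotE (bigD1 j) //= [delta_mx _ _ _ _]mxE !eqxx mulr1.
rewrite big1 ?addr0 // => i ij.
by rewrite [delta_mx _ _ _ _]mxE (negPf ij) mulr0.
Qed.

(** In the contraction the enthalpy and kinetic terms cancel. The pressure leaves u_m P / T = rho
    u_m R by the gas law, which is exactly the term subtracted. *)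
Lemma entropy_fluxE m :
  entropy_flux g m rho u T = - (rho * u m ord0 * thermo_entropy g rho T).
Proof.
rewrite /entropy_flux entropy_variables_conservative dotE sum5E.
rewrite /inviscid_flux !vec5_first !vec5_last.
have -> : \sum_i entropy_gradient (mid i) ord0
      * vec5 (rho * u m ord0)
          (\col_i (rho * u m ord0 * u i ord0 + (m == i)%:R * pressure g rho T))
          (rho * u m ord0 * total_enthalpy g u T) (mid i) ord0
    = T^-1 * (rho * u m ord0 * dot u u + u m ord0 * pressure g rho T).
  under eq_bigr => i _ do rewrite !vec5_mid !mxE mulrDr.
  rewrite big_split /= mulrDr; congr (_ + _).
    by rewrite dotE !mulr_sumr; apply: eq_bigr => i _; ring.
  (* The Kronecker delta keeps only the pressure term of index [m]. *)
  rewrite (bigD1 m) //= eqxx mul1r -mulrA big1 ?addr0 // => i im.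
  by rewrite eq_sym (negPf im) mul0r mulr0.
rewrite /pressure; field.
by rewrite gt_eqF.
Qed.

End State.
End EntropyVariables.

(** * Wall integrals and boundary conditions *)

Lemma eq_integral_wall (R : realType) (f h : 'cV[R]_3 -> R) :
  (forall xi, wall xi -> f xi = h xi) -> integral_wall f = integral_wall h.
Proof.
move=> fh; apply: eq_Rintegral => p; rewrite inE => -[p1 p2]; apply: fh.
split; last by rewrite mxE.
move: p1 p2; rewrite /= !in_itv /= => p1 p2.
move=> [[|[|[|//]]] i3]; rewrite mxE //=.
by rewrite lexx ler01.
Qed.

Lemma no_slip_no_penetration (R : realType) (M : mapping R) (w : flow R) tau :
  no_slip M w tau -> no_penetration M w tau.
Proof.
by move=> ns xi xi_wall; apply: big1 => m _; rewrite ns // subrr mulr0.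
Qed.

Section Wall.
Context {R : realType} (g : gas R) (M : mapping R) (w : flow R).
Hypotheses (hM : admissible_mapping M) (hw : smooth_flow M w).

Lemma inviscid_wall_integrandE tau xi : times M tau -> cube xi ->
  \sum_(m < 3) jac M tau xi * dxi_dx M ord0 m tau xi
    * (entropy_flux_field g w m tau xi
       - grid_velocity M tau xi m ord0 * entropy_field g w tau xi)
  = entropy_field g w tau xi
    * \sum_(m < 3) jac M tau xi * dxi_dx M ord0 m tau xi
        * (velocity w tau xi m ord0 - grid_velocity M tau xi m ord0).
Proof.
move=> htau hxi.
(* The chart contains the closed cube, so density and temperature are positive up to the wall. *)
have dom : domain M (tau, xi) by split=> //; exact: cube_sub_chart hM _ hxi.
rewrite mulr_sumr; apply: eq_bigr => m _.
rewrite /entropy_flux_field.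
rewrite (entropy_fluxE _ _ (density_gt0 hw dom) (temperature_gt0 hw dom)).
rewrite /entropy_field /math_entropy; ring.
Qed.

Lemma no_penetration_bounded
    (C : 'I_3 -> 'I_3 -> R -> 'cV[R]_3 -> 'M[R]_5) tau :
  times M tau -> entropy_balance g M w C tau -> no_penetration M w tau ->
  inviscid_contribution_bounded g M w C tau.
Proof.
move=> htau hbal np.
have inv0 xi : wall xi -> \sum_(m < 3) jac M tau xi * dxi_dx M ord0 m tau xi
    * (entropy_flux_field g w m tau xi
       - grid_velocity M tau xi m ord0 * entropy_field g w tau xi) = 0.
  move=> xi_wall; case: (xi_wall) => xi_cube _.
  by rewrite inviscid_wall_integrandE // np // mulr0.
split.
  rewrite /inviscid_wall_contribution (eq_integral_wall inv0).
  rewrite /integral_wall Rintegral_cst ?mul0r //.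
  exact: measurableX.
(* The inviscid part is removed inside the integrand; splitting the integral would call for
   integrability of each part. *)
move: hbal; rewrite /entropy_balance (@eq_integral_wall _ _ (fun xi =>
  \sum_(m < 3) - dot (W_field g w tau xi)
    (C ord0 m tau xi *m dref m (W_field g w) tau xi))) // => xi xi_wall.
by rewrite big_split /= inv0 // add0r.
Qed.

End Wall.

Theorem theorem2p2 (R : realType) (g : gas R) (M : mapping R) (w : flow R)
    (C : 'I_3 -> 'I_3 -> R -> 'cV[R]_3 -> 'M[R]_5)
    (hM : admissible_mapping M)
    (hw : smooth_flow M w)
    (hNS : ale_navier_stokes g M w)
    (hC : viscous_coefficients g M w C)
    (hbal : forall tau : R, times M tau -> entropy_balance g M w C tau) :
  forall tau : R, times M tau ->
    (no_slip M w tau -> inviscid_contribution_bounded g M w C tau) /\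
    (no_slip M w tau -> no_penetration M w tau) /\
    (no_penetration M w tau -> inviscid_contribution_bounded g M w C tau).
Proof.
move=> tau htau.
(* The no-slip bound is the no-penetration bound preceded by the implication between the two
   conditions. *)
have np := no_penetration_bounded hM hw htau (hbal _ htau).
split; last by split=> //; exact: no_slip_no_penetration.
by move=> /no_slip_no_penetration; exact: np.
Qed.
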